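(* Let $d > 2$ be an integer. There exists a constant $C > 0$, depending at most on $d$ (in particular independent of $p$, $\ell$, $q$ and $E$), such that the following holds. Let $q = p^{\ell}$ be odd, where $p$ is a prime and $\ell \geq 1$ is an integer. If $E \subset \mathbb{Z}_q^d$ satisfies $$|E| \geq C (\ell + 1)\, q^{\frac{(2\ell - 1)d + 2}{2\ell}},$$ then $\Delta(E) = \mathbb{Z}_q$.
   Context: $\mathbb{Z}_q$ denotes the ring of integers modulo $q$, and $\mathbb{Z}_q^d = \mathbb{Z}_q \times \dots \times \mathbb{Z}_q$ is the free module of rank $d$ over $\mathbb{Z}_q$. For $x = (x_1,\dots,x_d) \in \mathbb{Z}_q^d$ put $\|x\| = x_1^2 + \dots + x_d^2 \in \mathbb{Z}_q$. For $E \subset \mathbb{Z}_q^d$, the distance set is $\Delta(E) = \{\|x-y\| : x, y \in E\} = \{(x_1-y_1)^2 + \dots + (x_d-y_d)^2 : x,y \in E\} \subset \mathbb{Z}_q$. *)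

(* Defs.v *)
From HB Require Import structures.
From mathcomp Require Import all_boot all_order all_algebra.

Set Implicit Arguments.
Unset Strict Implicit.
Unset Printing Implicit Defensive.

Import GRing.Theory.
Local Open Scope ring_scope.

(* 'Z_q is the ring of integers modulo q only for q > 1. *)
Definition zq_norm (q d : nat) (x : 'rV['Z_q]_d) : 'Z_q :=
  \sum_(i < d) x 0 i ^+ 2.

Definition distance_set (q d : nat) (E : {set 'rV['Z_q]_d}) : {set 'Z_q} :=
  [set zq_norm (x - y) | x in E, y in E].

(* Main.v *)
(** Expand the indicator of [||x - y|| = t] in additive characters of Z_q.
    If [t] is not a distance, the trivial character contributes [|E|^2], so
    some of the sums [T_s = \sum_(x, y in E) chi (s ||x - y||)], s <> 0, must
    be large.  Cauchy-Schwarz in [x], then extending [x] to the whole module,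
    makes the exponent linear in [x], and orthogonality leaves only the pairs
    with [2 s (y - y') = 0]; this gives
    [|T_s|^2 <= |E|^2 q^d gcd(s, q)^d].  Since [gcd(s, q) <= p^(l-1)] for
    s <> 0 and [\sum_(s <> 0) gcd(s, q) <= l q], one gets
    [|E|^2 <= l^2 p^((2l-1)d+2)], so that [C = 1] works. *)
Require Import Defs.
From mathcomp Require Import all_boot all_order all_algebra.
From mathcomp Require Import reals exp.
From mathcomp Require Import algC cyclotomic.
From mathcomp Require Import ring zify.
Import Order.TTheory GRing.Theory Num.Theory.
Local Open Scope ring_scope.

(** * Additive characters of ['Z_q] *)

Lemma Zq_faithful_character (q : nat) : (1 < q)%N ->
  exists chi : 'Z_q -> algC,
    [/\ {morph chi : a b / a + b >-> a * b}, forall a, `|chi a| = 1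
      & forall a, chi a = 1 -> a = 0].
Proof.
move=> q1; have q0 : (0 < q)%N by exact: ltnW.
have [z zP] := C_prim_root_exists q0.
(* Addition in ['Z_q] reduces modulo [(Zp_trunc q).+2], which is [q] because [1 < q]; powers of a
   primitive [q]-th root do not see this reduction. *)
have zM i : z ^+ (i %% (Zp_trunc q).+2) = z ^+ i.
  by rewrite Zp_cast // (prim_expr_mod zP).
exists (fun a => z ^+ a); split.
- by move=> a b; rewrite -exprD -[RHS]zM.
- move=> a; apply/eqP; rewrite -(@pexpr_eq1 _ _ q) ?normr_ge0 //.
  by rewrite -normrX -exprM mulnC exprM (prim_expr_order zP) expr1n normr1.
move=> a /eqP; rewrite -(expr0 z) (eq_prim_root_expr zP) mod0n => /eqP a0.
by apply: val_inj; rewrite /= -a0 modn_small // -[ltnRHS](Zp_cast q1) ltn_ord.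
Qed.

Lemma character0 (V : zmodType) (chi : V -> algC) :
  {morph chi : a b / a + b >-> a * b} -> (forall a, `|chi a| = 1) -> chi 0 = 1.
Proof.
move=> chiD chi_norm.
have := chiD 0 0; rewrite addr0 -[LHS]mulr1 => /mulfI -> //.
by rewrite -normr_eq0 chi_norm oner_eq0.
Qed.

(** Translation by [v] permutes the summands, so the sum is fixed by multiplication by [f v], which
    differs from 1. *)
Lemma sum_character_eq0 (V : finZmodType) (f : V -> algC) (v : V) :
  {morph f : a b / a + b >-> a * b} -> f v != 1 -> \sum_x f x = 0.
Proof.
move=> fD fv1; apply/eqP; rewrite -(mulrI_eq0 _ (mulfI (x := f v - 1) _)).
  rewrite mulrBl mul1r mulr_sumr subr_eq0; apply/eqP.
  rewrite [RHS](reindex_inj (addrI v)).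
  by apply: eq_bigr => x _; rewrite fD.
by rewrite subr_eq0.
Qed.

(** * Cauchy-Schwarz and counting of residues *)

Lemma sqr_sum_le (I : finType) (A : {set I}) (a : I -> algC) :
  (forall i, 0 <= a i) ->
  (\sum_(i in A) a i) ^+ 2 <= #|A|%:R * \sum_(i in A) a i ^+ 2.
Proof.
move=> a0; have re i : a i \is Num.real by exact: ger0_real.
(* Expanded, this double sum is twice the right side minus the left side of the claim. *)
have : 0 <= \sum_(i in A) \sum_(j in A) (a i - a j) ^+ 2.
  apply: sumr_ge0 => i _; apply: sumr_ge0 => j _.
  by apply: real_exprn_even_ge0 => //; rewrite rpredB.
under eq_bigr => i _ do under eq_bigr => j _ do rewrite sqrrB.
under eq_bigr => i _ do
  rewrite big_split sumrB /= sumr_const sumrMnl -mulr_sumr.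
rewrite big_split sumrB /= sumr_const !sumrMnl -mulr_suml -expr2.
by rewrite addrAC -mulr2n -mulrnBl pmulrn_lge0 // subr_ge0 mulr_natl.
Qed.

Lemma card_dvdn_ord (n a b : nat) : (0 < a)%N -> n = (a * b)%N ->
  #|[set s : 'I_n | (a %| s)%N]| = b.
Proof.
move=> a0 ->; rewrite cardsE -sum1_card big_mkcond /=.
rewrite -(big_mkord xpredT (fun s => if (a %| s)%N then 1%N else 0%N)).
have [->|b0] := posnP b; first by rewrite muln0 big_geq.
rewrite -[RHS](mulKn b a0) divn_count_dvd.
(* [divn_count_dvd] counts over [1..a * b] whereas the ordinals run from 0 to [a * b - 1]; both
   extra endpoints are multiples of [a]. *)
rewrite big_ltn ?muln_gt0 ?a0 // dvdn0 big_nat_recr ?muln_gt0 ?a0 //=.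
by rewrite dvdn_mulr //= addnC.
Qed.

(* Counting [k] such that [p ^ k] divides [s] turns the sum into [l] sums of
   constant value. *)
Lemma sum_p_part_le (p l n : nat) : prime p -> n = (p ^ l)%N ->
  (\sum_(s < n | val s != 0%N) p ^ logn p s <= l * n)%N.
Proof.
move=> pp nE; have p0 := prime_gt0 pp.
have lt_logn (s : 'I_n) : val s != 0%N -> (logn p s < l)%N.
  rewrite -lt0n => s0; rewrite -(ltn_exp2l _ _ (prime_gt1 pp)) -nE.
  exact: leq_ltn_trans (dvdn_leq s0 (pfactor_dvdnn p s)) (ltn_ord s).
apply: (@leq_trans
  (\sum_(s < n) \sum_(j < l | (p ^ j %| s)%N) p ^ j)%N); last first.
  rewrite (exchange_big_dep predT) //=.
  apply: (@leq_trans (\sum_(j < l) n)%N); last first.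
    by rewrite sum_nat_const card_ord.
  apply: leq_sum => j _; rewrite sum_nat_const -cardsE.
  have le_jl : (j <= l)%N by exact: ltnW.
  have njE : n = (p ^ j * p ^ (l - j))%N by rewrite -expnD subnKC.
  by rewrite (card_dvdn_ord _ _ _ _ njE) ?expn_gt0 ?p0 // mulnC -njE.
rewrite big_mkcond; apply: leq_sum => s _; case: ifP => // s0.
rewrite (bigD1 (Ordinal (lt_logn s s0))) ?leq_addr //=.
exact: pfactor_dvdnn.
Qed.

(** With [s = p ^ j * m] and [m] prime to [p], [s * z = 0] forces [p ^ (l - j)] to divide [z], which
    leaves [p ^ j] residues; here [p ^ j] is gcd(s, q). *)
Lemma card_annihilator_Zq (p l q : nat) (s : 'Z_q) :
  prime p -> (1 <= l)%N -> q = (p ^ l)%N -> s != 0 ->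
  (#|[set z : 'Z_q | s * z == 0]%R| <= p ^ logn p s)%N.
Proof.
move=> pp l1 qE s0.
have q1 : (1 < q)%N by rewrite qE -(exp1n l) ltn_exp2r ?prime_gt1.
have cE := Zp_cast q1.
have s_gt0 : (0 < s)%N by rewrite lt0n.
have ltsq : (s < p ^ l)%N by rewrite -qE -[ltnRHS]cE.
have le_jl : (logn p s <= l)%N.
  rewrite -(leq_exp2l _ _ (prime_gt1 pp)) ltnW //.
  exact: leq_ltn_trans (dvdn_leq s_gt0 (pfactor_dvdnn p s)) ltsq.
have nE : (Zp_trunc q).+2 = (p ^ (l - logn p s) * p ^ logn p s)%N.
  by rewrite -expnD subnK // -qE.
rewrite -[leqRHS](card_dvdn_ord _ _ _ _ nE) ?expn_gt0 ?prime_gt0 //.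
apply/subset_leq_card/subsetP => z; rewrite !inE => /eqP sz0.
have : (p ^ l %| s * z)%N.
  rewrite -qE -[X in (X %| _)%N]cE; apply/eqP.
  exact: (congr1 (@nat_of_ord _) sz0).
have [m cpm sE] := pfactor_coprime pp s_gt0.
rewrite {1}sE -mulnA Gauss_dvdr ?coprimeXl // ?prime_coprime //.
by rewrite -{1}(subnK le_jl) expnD mulnC dvdn_pmul2l.
Qed.

Lemma card_row_forall_in (T : finType) (d : nat) (B : {set T}) :
  (#|[set w : 'rV[T]_d | [forall i, w 0%R i \in B]]| <= #|B| ^ d)%N.
Proof.
rewrite -[d in leqRHS]card_ord -card_ffun_on.
rewrite -(card_in_imset (f := fun w : 'rV[T]_d => [ffun i => w 0 i])).
  apply/subset_leq_card/subsetP => _ /imsetP[w wP ->].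
  apply/ffun_onP => i; rewrite ffunE.
  by move: wP; rewrite inE => /forallP.
move=> u v _ _ /ffunP uv; apply/rowP => i.
by have := uv i; rewrite !ffunE.
Qed.

(** * Exponential sums over distances *)

Definition dot {q d : nat} (x y : 'rV['Z_q]_d) : 'Z_q :=
  \sum_(i < d) x 0 i * y 0 i.

(** The quadratic term in [x] cancels, so summing over [x] becomes a linear character sum. *)
Lemma zq_norm_sub_diff (q d : nat) (x y y' : 'rV['Z_q]_d) :
  zq_norm (x - y) - zq_norm (x - y') =
  dot x (2 *: (y' - y)) + (zq_norm y - zq_norm y').
Proof.
rewrite /zq_norm /dot -!sumrB -big_split /=; apply: eq_bigr => i _.
by rewrite !mxE; ring.
Qed.

Lemma sum_character_dot (q d : nat) (chi : 'Z_q -> algC) (w : 'rV['Z_q]_d) :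
  {morph chi : a b / a + b >-> a * b} -> (forall a, chi a = 1 -> a = 0) ->
  w != 0 -> \sum_(x : 'rV['Z_q]_d) chi (dot x w) = 0.
Proof.
move=> chiD chi_inj; case/rV0Pn => i wi.
(* At the basis vector of a nonzero coordinate of [w] the character takes the value [chi (w 0 i)],
   which is not 1 by faithfulness. *)
apply: (sum_character_eq0 _ (fun x => chi (dot x w)) (delta_mx 0 i)).
  move=> x y /=; rewrite -chiD; congr chi.
  by rewrite /dot -big_split; apply: eq_bigr => j _; rewrite !mxE mulrDl.
apply: contra wi => /eqP/chi_inj; rewrite /dot (bigD1 i) //= big1 => [|j ji].
  by rewrite !mxE !eqxx mul1r addr0 => ->.
by rewrite !mxE (negPf ji) andbF mul0r.
Qed.

Definition dist_sum {q d : nat} (chi : 'Z_q -> algC) (E : {set 'rV['Z_q]_d})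
    (s : 'Z_q) : algC :=
  \sum_(x in E) \sum_(y in E) chi (s * zq_norm (x - y)).

Lemma dist_sum_sqr_le (q d : nat) (chi : 'Z_q -> algC)
    (E : {set 'rV['Z_q]_d}) (s : 'Z_q) (m : nat) :
  (1 < q)%N -> odd q ->
  {morph chi : a b / a + b >-> a * b} -> (forall a, `|chi a| = 1) ->
  (forall a, chi a = 1 -> a = 0) ->
  (#|[set z : 'Z_q | s * z == 0]%R| <= m)%N ->
  `|dist_sum chi E s| ^+ 2 <= #|E|%:R ^+ 2 * (q ^ d * m ^ d)%:R.
Proof.
move=> q1 oq chiD chi_norm chi_inj le_m.
have chi0 := character0 _ _ chiD chi_norm.
have chiN a : chi (- a) = (chi a)^*.
  apply: (@mulfI _ (chi a)); first by rewrite -normr_eq0 chi_norm oner_eq0.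
  by rewrite -chiD subrr chi0 -normCK chi_norm expr1n.
(* Oddness of [q] enters here: 2 is a unit. *)
have two_inj : injective (fun z : 'Z_q => 2 * z).
  by apply: mulrI; rewrite unitZpE // coprimen2.
pose F x := \sum_(y in E) chi (s * zq_norm (x - y)).
pose W y y' : 'rV['Z_q]_d := s *: (2 *: (y' - y)).
have F2E : \sum_x `|F x| ^+ 2 = \sum_(y in E) \sum_(y' in E)
    chi (s * (zq_norm y - zq_norm y'))
    * \sum_x chi (dot x (W y y')).
  transitivity (\sum_x \sum_(y in E) \sum_(y' in E)
    chi (s * (zq_norm (x - y) - zq_norm (x - y')))).
    apply: eq_bigr => x _; rewrite normCK rmorph_sum mulr_suml.
    apply: eq_bigr => y _; rewrite mulr_sumr; apply: eq_bigr => y' _.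
    by rewrite /= -chiN -chiD mulrBr.
  rewrite exchange_big; apply: eq_bigr => y _.
  rewrite exchange_big; apply: eq_bigr => y' _.
  rewrite mulr_sumr; apply: eq_bigr => x _; rewrite -chiD; congr chi.
  rewrite zq_norm_sub_diff mulrDr addrC; congr (_ + _).
  by rewrite /dot mulr_sumr; apply: eq_bigr => i _; rewrite !mxE mulrCA.
have F2le : \sum_x `|F x| ^+ 2 <= #|E|%:R * (q ^ d * m ^ d)%:R.
  have F2ge0 : 0 <= \sum_x `|F x| ^+ 2.
    by apply: sumr_ge0 => x _; rewrite exprn_ge0.
  rewrite -(ger0_norm F2ge0) F2E.
  apply: (le_trans (ler_norm_sum _ _ _)).
  rewrite mulr_natl -sumr_const; apply: ler_sum => y _.
  apply: (le_trans (ler_norm_sum _ _ _)).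
  (* By orthogonality the sum over [x] vanishes unless [W y y' = 0], where it has [q ^ d] terms of
     modulus 1. *)
  apply: (@le_trans _ _ (\sum_(y' in E) (q ^ d * (W y y' == 0))%:R)).
    apply: ler_sum => y' _; rewrite normrM chi_norm mul1r.
    have [->|W0] := eqVneq (W y y') 0; last first.
      by rewrite sum_character_dot // normr0.
    rewrite muln1 (le_trans (ler_norm_sum _ _ _)) //.
    rewrite (eq_bigr (fun=> 1)) => [|x _]; last by rewrite chi_norm.
    by rewrite sumr_const card_mx card_ord Zp_cast // mul1n.
  rewrite -natr_sum ler_nat -big_distrr /= leq_mul2l; apply/orP; right.
  (* For fixed [y], the injection sending [y'] to [2 *: (y' - y)] maps the surviving [y'] to rows
     with all entries in [A]. *)
  pose A := [set z : 'Z_q | s * z == 0].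
  apply: (@leq_trans (#|A| ^ d)); last first.
    by case: (d) => [|e]; rewrite ?expn0 ?leq_exp2r.
  apply: leq_trans (card_row_forall_in _ d A).
  rewrite (eq_bigr (fun y' => if W y y' == 0 then 1%N else 0%N)); last first.
    by move=> y' _; case: (_ == _).
  rewrite -big_mkcondr sum1dep_card.
  rewrite -(card_in_imset (f := fun y' => 2 *: (y' - y))); last first.
    move=> u v _ _ /rowP uv; apply/rowP => i; have := uv i; rewrite !mxE.
    by move=> /two_inj/addIr.
  apply/subset_leq_card/subsetP => _ /imsetP[y' + ->].
  rewrite !inE => /andP[_ /eqP/rowP W0]; apply/forallP => i; rewrite inE.
  by have := W0 i; rewrite !mxE => ->.
have T_le : `|dist_sum chi E s| <= \sum_(x in E) `|F x| by exact: ler_norm_sum.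
rewrite expr2 -mulrA; apply: le_trans (_ : _ <= #|E|%:R * _) _; last first.
  by apply: ler_wpM2l F2le; rewrite ler0n.
apply: le_trans (lerXn2r 2 _ _ T_le) _; rewrite ?nnegrE ?sumr_ge0 //.
apply: le_trans (sqr_sum_le _ _ _ _) _ => //.
apply: ler_wpM2l; first by rewrite ler0n.
(* Passing from [E] to the whole module only adds nonnegative terms. *)
rewrite [leRHS](bigID [in E]) /= lerDl sumr_ge0 // => x _.
by rewrite exprn_ge0.
Qed.

(** * From character sums to the size of [E] *)

Lemma missing_distance_card_sqr_le (p l q d : nat) (E : {set 'rV['Z_q]_d})
    (t : 'Z_q) :
  (1 < d)%N -> prime p -> (1 <= l)%N -> q = (p ^ l)%N -> odd q ->
  t \notin distance_set E ->
  (#|E| ^ 2 <= l ^ 2 * p ^ ((2 * l - 1) * d + 2))%N.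
Proof.
move=> d1 pp l1 qE oq tE.
have q1 : (1 < q)%N by rewrite qE -(exp1n l) ltn_exp2r ?prime_gt1.
have [chi [chiD chi_norm chi_inj]] := Zq_faithful_character _ q1.
have chi0 := character0 _ _ chiD chi_norm.
have T0 : dist_sum chi E 0 = #|E|%:R ^+ 2.
  rewrite /dist_sum; under eq_bigr do under eq_bigr do rewrite mul0r chi0.
  by under eq_bigr do rewrite sumr_const; rewrite sumr_const expr2 mulr_natr.
(* Each pair contributes a sum over [s] of a character that is nontrivial at [s = 1], since
   [zq_norm (x - y)] is never [t]. *)
have sum0 : \sum_s chi (s * - t) * dist_sum chi E s = 0.
  under eq_bigr => s _ do rewrite mulr_sumr.
  rewrite exchange_big big1 //= => x xE.
  under eq_bigr => s _ do rewrite mulr_sumr.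
  rewrite exchange_big big1 //= => y yE.
  under eq_bigr => s _ do rewrite -chiD -mulrDr.
  apply: (sum_character_eq0 _ (fun s => chi (s * _)) 1) => [a b|].
    by rewrite mulrDl chiD.
  rewrite mul1r; apply: contra tE => /eqP/chi_inj/eqP.
  rewrite addrC subr_eq0 => /eqP <-; exact: imset2_f.
pose w (s : 'Z_q) := (p ^ logn p s)%N.
(* Split [w s ^ d] as [w s ^ (d - 2) * w s ^ 2]: the first factor is bounded by its maximum, using
   [w s <= p ^ l.-1], and goes into [M]; the second leaves [w s] after the square root, to be summed
   over [s]. *)
pose M : algC := sqrtC (q ^ d * p ^ (l.-1 * (d - 2)))%:R.
have M0 : 0 <= M by rewrite sqrtC_ge0 ler0n.
have T_le s : s != 0 -> `|dist_sum chi E s| <= #|E|%:R * M * (w s)%:R.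
  move=> s0.
  rewrite -(ler_pXn2r (n := 2)) ?nnegrE ?mulr_ge0 ?ler0n //.
  have le_w := card_annihilator_Zq _ _ _ _ pp l1 qE s0.
  apply: le_trans
    (dist_sum_sqr_le _ _ _ _ _ _ q1 oq chiD chi_norm chi_inj le_w) _.
  rewrite !exprMn sqrtCK -mulrA -natrX -natrM -/(w s).
  rewrite -natrX -!natrM ler_nat -mulnA !leq_mul2l; apply/orP; right.
  apply/orP; right.
  rewrite -{1}(subnK d1) expnD leq_mul2r; apply/orP; right.
  rewrite /w -expnM leq_exp2l ?prime_gt1 // leq_mul2r; apply/orP; right.
  rewrite -ltnS prednK // -(ltn_exp2l _ _ (prime_gt1 pp)).
  have s_gt0 : (0 < s)%N by rewrite lt0n.
  apply: leq_ltn_trans (dvdn_leq s_gt0 (pfactor_dvdnn p s)) _.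
  by rewrite -qE -[ltnRHS](Zp_cast q1).
have cardE_le : #|E|%:R <= M * (l * q)%:R.
  have [->|E0] := posnP #|E|; first by rewrite mulr_ge0 ?ler0n.
  rewrite -(ler_pM2l (x := #|E|%:R)) ?ltr0n // -expr2.
  have -> : #|E|%:R ^+ 2 = `|#|E|%:R ^+ 2| :> algC.
    by rewrite ger0_norm // exprn_ge0 ?ler0n.
  (* The term [s = 0] equals [#|E| ^ 2], hence is minus the sum of all the others. *)
  move/eqP: sum0; rewrite (bigD1 0) //= T0 mul0r chi0 mul1r addr_eq0 => /eqP ->.
  rewrite normrN (le_trans (ler_norm_sum _ _ _)) //.
  apply: (@le_trans _ _ (\sum_(s : 'Z_q | s != 0) #|E|%:R * M * (w s)%:R)).
    by apply: ler_sum => s s0; rewrite normrM chi_norm mul1r T_le.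
  rewrite -mulr_sumr mulrA; apply: ler_wpM2l; first by rewrite mulr_ge0 ?ler0n.
  have cE := Zp_cast q1; rewrite -natr_sum ler_nat -[in leqRHS]cE.
  by apply: sum_p_part_le; rewrite // cE.
rewrite -(ler_nat algC) natrX.
apply: le_trans (lerXn2r 2 _ _ cardE_le) _; rewrite ?nnegrE ?mulr_ge0 ?ler0n //.
rewrite exprMn sqrtCK -natrX -natrM ler_nat qE expnMn mulnCA leq_mul2l.
apply/orP; right; rewrite -!expnM -!expnD leq_exp2l ?prime_gt1 //.
(* The exponents match: l d + (l - 1)(d - 2) + 2 l = (2 l - 1) d + 2. Shifting [d] and [l] removes
   the truncated subtractions. *)
have [e ->] : exists e, d = e.+2 by exists (d - 2)%N; lia.
have [k ->] : exists k, l = k.+1 by exists l.-1; lia.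
have -> : (2 * k.+1 - 1 = 2 * k + 1)%N by lia.
by rewrite /= subn2 /=; lia.
Qed.

Theorem corollary1p7 (R : realType) (d : nat) (hd : (2 < d)%N) :
  exists C : R, 0 < C /\
    forall (p l q : nat),
      prime p -> (1 <= l)%N -> q = (p ^ l)%N -> odd q ->
      forall E : {set 'rV['Z_q]_d},
        C * (l%:R + 1)
          * q%:R `^ (((2 * l%:R - 1) * d%:R + 2) / (2 * l%:R)) <= #|E|%:R ->
        distance_set E = [set: 'Z_q].
Proof.
exists 1; split => // p l q pp l1 qE oq E leE.
apply/eqP; rewrite -subTset; apply/subsetP => t _; apply/negPn/negP => tE.
have := missing_distance_card_sqr_le _ _ _ _ _ _ (ltnW hd) pp l1 qE oq tE.
apply/negP; rewrite -ltnNge -(ltr_nat R) natrX.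
set e := ((2 * l - 1) * d + 2)%N.
have p_gt0 : (0 : R) < p%:R by rewrite ltr0n prime_gt0.
(* Since [q = p ^ l], the threshold power is p^(e/2); squaring makes the exponent an integer. *)
have powE : (q%:R `^ (((2 * l%:R - 1) * d%:R + 2) / (2 * l%:R))) ^+ 2
    = (p ^ e)%:R :> R.
  rewrite -powR_mulrn ?powR_ge0 // -powRrM qE natrX -powR_mulrn ?ltW //.
  rewrite -powRrM natrX -powR_mulrn ?ltW //; congr (_ `^ _).
  rewrite /e natrD natrM natrB ?muln_gt0 // natrM.
  by field; rewrite pnatr_eq0 -lt0n.
(* The factor [l + 1] in place of [l] makes the inequality strict, so that [C = 1] suffices. *)
apply: (@lt_le_trans _ _ ((l%:R + 1) ^+ 2 * (p ^ e)%:R)).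
  rewrite natrM ltr_pM2r ?ltr0n ?expn_gt0 ?prime_gt0 // natr1 -natrX ltr_nat.
  by rewrite ltn_exp2r.
rewrite -powE -exprMn; apply: lerXn2r; rewrite ?nnegrE ?ler0n //.
  by rewrite mulr_ge0 ?powR_ge0 // addr_ge0.
by rewrite mul1r in leE.
Qed.
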